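(* Define integers $a_{m,n}$ for nonnegative integers $m,n$ by: $a_{m,0}=0$ for all $m\ge 0$; $a_{0,1}=1$; $a_{0,n}=0$ for all $n>1$; and for $m\ge1$, $n\ge 1$, \[ a_{m,n}=\sum_{i=0}^{m-1} \binom{m-1}{i} a_{m-1-i,n-1} - \sum_{i=1}^{m-1} \binom{m-1}{i} a_{m-1-i,n}. \] Then for all nonnegative integers $m,n$, the complete bipartite graph $K_{m,n}$ satisfies \[ C(K_{m,n})= \sum_{i=1}^{m+1} a_{m,i}\, i^n . \]
   Context: For a finite labelled graph $G$, a composition of $G$ is a partition of the vertex set $V(G)$ into nonempty blocks such that each block induces a connected subgraph of $G$. $C(G)$ denotes the number of distinct compositions of $G$. $K_{m,n}$ is the complete bipartite graph with parts of sizes $m$ and $n$ ($m+n$ vertices, $mn$ edges); when $m=0$ or $n=0$ it is the edgeless graph, which has exactly one composition. *)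

(* Defs.v *)
From mathcomp Require Import all_boot all_order all_algebra.

Set Implicit Arguments.
Unset Strict Implicit.
Unset Printing Implicit Defensive.

Import GRing.Theory.
Local Open Scope ring_scope.

(* A graph on the vertex set T is given by its adjacency relation e : rel T. *)

Definition induced_rel (T : finType) (e : rel T) (B : {set T}) : rel T :=
  [rel x y | [&& x \in B, y \in B & e x y]].

Definition connected_in (T : finType) (e : rel T) (B : {set T}) : bool :=
  [forall x in B, forall y in B, connect (induced_rel e B) x y].

(* [partition P D] includes set0 \notin P, so all blocks are nonempty. *)
Definition compositions (T : finType) (e : rel T) : {set {set {set T}}} :=
  [set P | partition P [set: T] & [forall B in P, connected_in e B]].

Definition num_compositions (T : finType) (e : rel T) : nat :=
  #|compositions e|.

Definition Kmn (m n : nat) : rel ('I_m + 'I_n) :=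
  fun u v => match u, v with
             | inl _, inr _ | inr _, inl _ => true
             | _, _ => false
             end.

Lemma Kmn_sym (m n : nat) : symmetric (@Kmn m n).
Proof. by case=> [i|i] [j|j]. Qed.

Lemma Kmn_irrefl (m n : nat) : irreflexive (@Kmn m n).
Proof. by case. Qed.

(* The coefficient a_{m,n}; in the last case p = m - 1 and q = n - 1. *)
Fixpoint acoef (m n : nat) {struct m} : int :=
  match m, n with
  | _, 0%N => 0
  | 0%N, 1%N => 1
  | 0%N, _ => 0
  | p.+1, q.+1 =>
      \sum_(0 <= i < p.+1) ('C(p, i))%:Z * acoef (p - i)%N q
      - \sum_(1 <= i < p.+1) ('C(p, i))%:Z * acoef (p - i)%N q.+1
  end.

(* Main.v *)
(* Let S(m, n) be the right-hand side. The recurrence for a_(m, n) translates into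
     S(m+1, n) = S(m, n)
       + \sum_(i >= 0) \sum_(j >= 1) 'C(m, i) 'C(n, j) S(m - i, n - j),
   with S(0, n) = 1. The number of compositions satisfies the same recurrence:
   a vertex of the left part is either a block by itself, or lies in a block
   with i further left vertices and j >= 1 right vertices, since a block with at
   least two vertices is connected exactly when it meets both parts. *)
Require Import Defs.
From mathcomp Require Import all_boot all_order all_algebra.

Set Implicit Arguments.
Unset Strict Implicit.
Unset Printing Implicit Defensive.

Import GRing.Theory.
Local Open Scope ring_scope.

Lemma acoef0r (m : nat) : acoef m 0 = 0.
Proof. by case: m. Qed.

(** Adding and subtracting the i = 0 term gives both sums the same range, so they merge into
    differences of neighbouring coefficients. *)
Lemma acoefSS (p q : nat) :
  acoef p.+1 q.+1 = acoef p q.+1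
    + \sum_(i < p.+1) ('C(p, i))%:Z * (acoef (p - i) q - acoef (p - i) q.+1).
Proof.
have -> : acoef p.+1 q.+1 =
   \sum_(0 <= i < p.+1) ('C(p, i))%:Z * acoef (p - i)%N q
      - \sum_(1 <= i < p.+1) ('C(p, i))%:Z * acoef (p - i)%N q.+1 by [].
under [in RHS]eq_bigr => i _ do rewrite mulrBr.
rewrite sumrB big_mkord addrCA; congr (_ + _).
rewrite -(big_mkord xpredT (fun i => ('C(p, i))%:Z * acoef (p - i) q.+1)).
by rewrite [in RHS]big_ltn // bin0 mul1r subn0 opprD addNKr.
Qed.

Lemma acoef_eq0 (m n : nat) : (m.+1 < n)%N -> acoef m n = 0.
Proof.
elim/ltn_ind: m n => -[|p] IH [|q] // lt_pq; first by case: q lt_pq.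
rewrite acoefSS IH ?add0r //; last exact: ltnW.
apply: big1 => i _; have lt_piq : ((p - i).+1 < q)%N.
  by apply: leq_ltn_trans (lt_pq : p.+1 < q)%N; rewrite ltnS leq_subr.
by rewrite !IH ?subrr ?mulr0 ?ltnS ?leq_subr // ltnW.
Qed.

Definition apow (m n : nat) : int :=
  \sum_(1 <= i < m.+2) acoef m i * i%:Z ^+ n.

(** Coefficients vanish beyond m + 1 and at i = 0, which matters for n = 0 where 0^0 = 1; hence
    power sums with different m can share one index range. *)
Lemma apow_widen (N m n : nat) :
  (m.+1 < N)%N -> apow m n = \sum_(i < N) acoef m i * i%:Z ^+ n.
Proof.
move=> lt_mN; rewrite -(big_mkord xpredT (fun i => acoef m i * i%:Z ^+ n)).
rewrite big_ltn ?(leq_trans _ lt_mN) // acoef0r mul0r add0r.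
rewrite (@big_cat_nat _ _ _ m.+2) //= [X in _ = _ + X]big1_seq ?addr0 //.
by move=> i /andP[_]; rewrite mem_index_iota => /andP[lt_mi _]; rewrite acoef_eq0 ?mul0r.
Qed.

Lemma apow0 (n : nat) : apow 0 n = 1.
Proof. by rewrite /apow big_nat1 mul1r expr1n. Qed.

(* The coefficient recurrence gives \sum_q a_(k, q) ((q + 1)^n - q^n), which
   the binomial theorem expands; the term j = 0 cancels. *)
Lemma apowS (m n : nat) :
  apow m.+1 n = apow m n
    + \sum_(i < m.+1) ('C(m, i))%:Z *
        \sum_(1 <= j < n.+1) ('C(n, j))%:Z * apow (m - i) (n - j).
Proof.
(* The range m + 2 serves every k <= m and is also that of [apow m.+1 n], so the sums over q and i
   can be exchanged. *)
have shift k : (k <= m)%N ->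
    apow k n = \sum_(q < m.+2) acoef k q.+1 * q.+1%:Z ^+ n.
  move=> le_km; rewrite (@apow_widen m.+3) ?ltnS 1?ltnW ?ltnS //.
  by rewrite big_ord_recl acoef0r mul0r add0r.
rewrite {1}/apow big_add1 big_mkord shift //.
under eq_bigr => q _ do rewrite acoefSS mulrDl mulr_suml.
rewrite big_split exchange_big; congr (_ + _); apply: eq_bigr => i _.
under eq_bigr => q _ do rewrite -mulrA mulrBl.
rewrite -mulr_sumr sumrB -shift ?leq_subr //; congr (_ * _).
rewrite (@apow_widen m.+2) ?ltnS ?leq_subr // -sumrB.
under [RHS]eq_bigr => j _.
  rewrite (@apow_widen m.+2) ?ltnS ?leq_subr // mulr_sumr. over.
rewrite exchange_big; apply: eq_bigr => q _.
under eq_bigr => j _ do rewrite mulrCA.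
rewrite -mulrBr -mulr_sumr; congr (_ * _).
rewrite -[q.+1]addn1 PoszD exprDn big_ord_recl bin0 subn0 mulr1 addrC addKr.
rewrite big_add1 big_mkord; apply: eq_bigr => j _.
by rewrite expr1n mulr1 -mulr_natl natz.
Qed.

(** The ground set varies because deleting a block leaves a partition of the remaining vertices. *)
Definition partitions_in (T : finType) (Q : pred {set T}) (A : {set T}) :
    {set {set {set T}}} :=
  [set P | partition P A & [forall B in P, Q B]].

Lemma card_partitions_in0 (T : finType) (Q : pred {set T}) :
  #|partitions_in Q set0| = 1%N.
Proof.
apply/eqP/cards1P; exists set0; apply/setP => P; rewrite !inE partition_set0.
by apply: andb_idr => /eqP->; apply/forall_inP => B; rewrite inE.
Qed.

(** Sort by the block B containing x: deleting B is a bijection onto the admissible partitions of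
    [A :\: B]. *)
Lemma card_partitions_in_rec (T : finType) (Q : pred {set T}) (A : {set T}) (x : T) :
  x \in A ->
  #|partitions_in Q A| =
    (\sum_(B : {set T} | [&& B \subset A, x \in B & Q B]) #|partitions_in Q (A :\: B)|)%N.
Proof.
move=> Ax; rewrite -sum1_card.
rewrite (partition_big (fun P => pblock P x)
  (fun B : {set T} => [&& B \subset A, x \in B & Q B])) /=; last first.
  move=> P; rewrite inE => /andP[partP /forall_inP QP].
  have xP : x \in cover P by rewrite (cover_partition partP).
  by rewrite mem_pblock xP QP ?pblock_mem // (partitionS partP) ?pblock_mem.
apply: eq_bigr => B /and3P[sBA Bx QB]; rewrite sum1_card.
(* B contains x, which is absent from [A :\: B]; this makes adding B to such a partition
   injective. *)
have B_notin P : P \in partitions_in Q (A :\: B) -> B \notin P.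
  rewrite inE => /andP[partP _]; apply/negP => /(partitionS partP)/subsetP/(_ x Bx).
  by rewrite inE Bx.
rewrite -(@card_in_imset _ _ (fun P => B |: P) (partitions_in Q (A :\: B))); last first.
  by move=> P1 P2 /B_notin nP1 /B_notin nP2 eqP12; rewrite -(setU1K nP1) eqP12 setU1K.
apply: eq_card => P; rewrite unfold_in /=; apply/andP/imsetP => [[]|[P']].
  rewrite inE => /andP[partP /forall_inP QP] /eqP eqB.
  have PB : B \in P by rewrite -eqB pblock_mem ?(cover_partition partP).
  exists (P :\ B); last by rewrite setD1K.
  rewrite inE partitionD1 //=; apply/forall_inP => C /setD1P[_]; exact: QP.
move=> P'in ->{P}; move: P'in; rewrite inE => /andP[partP /forall_inP QP].
have partU : partition (B |: P') A.
  rewrite -(setID A B) (setIidPr sBA) partitionU1 //; first by apply/set0Pn; exists x.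
  by rewrite -setI_eq0 setIDA setD_eq0 subsetIl.
rewrite inE partU (def_pblock (partition_trivIset partU) _ Bx) ?setU11 //=; split=> //.
by apply/forall_inP => C /setU1P[->|/QP].
Qed.

(* The complete bipartite graph on T with parts L and ~: L. *)
Definition cut_rel (T : finType) (L : {set T}) : rel T :=
  fun x y => (x \in L) != (y \in L).

(** One edge from x to y suffices: vertices of B opposite x are adjacent to x, those on the side of
    x are adjacent to y. Conversely, a path from x to another vertex starts with such an edge. *)
Lemma connected_in_cut (T : finType) (L B : {set T}) (x : T) : x \in B ->
  connected_in (cut_rel L) B = (B == [set x]) || [exists y in B, cut_rel L x y].
Proof.
move=> Bx; apply/forall_inP/orP => [connB | [/eqP-> | /exists_inP[y By xy]]].
- case: (altP eqP) => [|neqB]; [by left | right].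
  have [z Bz neq_zx] : exists2 z, z \in B & z != x.
    apply/exists_inP; apply: contraR neqB => /exists_inPn nB.
    rewrite eqEsubset sub1set Bx andbT; apply/subsetP => z /nB.
    by rewrite inE negbK.
  case/connectP: (forall_inP (connB x Bx) z Bz) => -[|y p] /=.
    by move=> _ eq_zx; rewrite eq_zx eqxx in neq_zx.
  by case/andP=> /and3P[_ By xy] _ _; apply/exists_inP; exists y.
- move=> y /set1P->; apply/forall_inP => z /set1P->; exact: connect0.
have symB : connect_sym (induced_rel (cut_rel L) B).
  apply: sym_connect_sym => u v; rewrite /induced_rel /= /cut_rel andbCA.
  by rewrite [(u \in L) == _]eq_sym.
have edge u v : u \in B -> v \in B -> cut_rel L u v ->
    connect (induced_rel (cut_rel L) B) u v.
  by move=> Bu Bv uv; apply: connect1; rewrite /induced_rel /= Bu Bv.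
have toX z : z \in B -> connect (induced_rel (cut_rel L) B) x z.
  move=> Bz; have [xz|] := boolP (cut_rel L x z).
    exact: edge.
  rewrite negbK => /eqP eq_xz; apply: connect_trans (edge x y Bx By xy) _.
  by apply: edge; rewrite // /cut_rel -eq_xz eq_sym.
move=> u Bu; apply/forall_inP => v Bv.
by apply: connect_trans (toX v Bv); rewrite symB toX.
Qed.

Lemma sum_subsets_card (T : finType) (X : {set T}) (F : nat -> int) :
  \sum_(U : {set T} | U \subset X) F #|U| = \sum_(i < #|X|.+1) ('C(#|X|, i))%:Z * F i.
Proof.
(* [inord] gives the grouping by size a finite index type; its default value never occurs, since U
   lies in X. *)
rewrite (partition_big (fun U : {set T} => inord #|U| : 'I_#|X|.+1) xpredT) //=.
apply: eq_bigr => i _; rewrite -(cards_draws X i) -natz mulr_natl -sumr_const.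
have cardK (U : {set T}) : U \subset X -> (inord #|U| : 'I_#|X|.+1) = #|U| :> nat.
  by move=> sUX; rewrite inordK // ltnS subset_leq_card.
apply: eq_big => [U | U /andP[sUX /eqP <-]]; last by rewrite cardK.
by rewrite inE; apply: andb_id2l => sUX; rewrite -val_eqE /= cardK.
Qed.

(** Disjointness makes intersecting B with X and with Y inverse to taking the union. *)
Lemma sum_subsets_split (T : finType) (X Y : {set T}) (F : {set T} -> int) :
  [disjoint X & Y] ->
  \sum_(B : {set T} | B \subset X :|: Y) F B =
    \sum_(U : {set T} | U \subset X) \sum_(V : {set T} | V \subset Y) F (U :|: V).
Proof.
move=> disXY; rewrite pair_big /=.
rewrite (reindex_onto (fun p : {set T} * {set T} => p.1 :|: p.2)
   (fun B => (B :&: X, B :&: Y))) /=; last first.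
  by move=> B sB; rewrite -setIUr; apply/setIidPl.
apply: eq_bigl => -[U V] /=; apply/andP/andP => [[sUV /eqP[<- <-]]|[sUX sVY]].
  by rewrite !subsetIr.
have UY : U :&: Y = set0.
  by apply/eqP; rewrite setI_eq0; apply: disjointWl disXY.
have VX : V :&: X = set0.
  by apply/eqP; rewrite setIC setI_eq0; apply: disjointWr disXY.
rewrite setUSS //; split=> //.
by rewrite !setIUl VX UY set0U setU0 (setIidPl sUX) (setIidPl sVY).
Qed.

(** Strong induction on [#|A|]: sorting by the block of a vertex in L reproduces the recurrence
    [apowS]. *)
Lemma card_partitions_in_cut (T : finType) (L A : {set T}) :
  #|partitions_in (connected_in (cut_rel L)) A|%:Z = apow #|A :&: L| #|A :\: L|.
Proof.
set N := fun A : {set T} => #|partitions_in (connected_in (cut_rel L)) A|%:Z.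
rewrite -/(N A); have [k] := ubnP #|A|; elim: k A => // k IH A; rewrite ltnS => leAk.
have IHD x (B : {set T}) : x \in A -> x \in B ->
    N (A :\: B) = apow #|(A :\: B) :&: L| #|(A :\: B) :\: L|.
  move=> Ax Bx; apply: IH; apply: leq_trans leAk; apply: proper_card.
  by apply/properP; split; [apply: subsetDl | exists x; rewrite // inE Bx].
have recN x : x \in A -> N A = N (A :\ x)
    + \sum_(B : {set T} | [&& B \subset A, x \in B & [exists y in B, cut_rel L x y]])
        N (A :\: B).
  move=> Ax; rewrite /N (card_partitions_in_rec _ Ax) -natz natr_sum.
  under eq_bigr => B _ do rewrite natz.
  rewrite (bigD1 [set x]) /=; last first.
    by rewrite sub1set Ax set11 (connected_in_cut _ (set11 x)) eqxx.
  congr (_ + _); apply: eq_bigl => B; rewrite -!andbA; apply: andb_id2l => _.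
  apply: andb_id2l => Bx; rewrite (connected_in_cut _ Bx).
  have [->|//] := eqVneq B [set x]; last by rewrite andbT.
  apply/esym/exists_inP => -[y /set1P->]; by rewrite /cut_rel eqxx.
have [-> | [x Ax]] := set_0Vmem A.
  by rewrite /N card_partitions_in0 set0I set0D !cards0 apow0.
(* Without left vertices there are no edges, so x is alone in its block and both sides equal 1. *)
have [AL0 | [y /setIP[Ay Ly]]] := set_0Vmem (A :&: L).
  rewrite (recN x Ax) big_pred0 => [|B].
    by rewrite (IHD x) ?set11 // setIDAC AL0 set0D cards0 !apow0 addr0.
  apply/and3P => -[/subsetP sBA Bx /exists_inP[y By]].
  have nL z : z \in B -> z \in L = false.
    by move=> /sBA Az; apply/negP => Lz; have := in_set0 z; rewrite -AL0 inE Az Lz.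
  by rewrite /cut_rel !nL.
(* X and Y hold the left and right vertices that may join y in its block; their sizes are the m and
   n of [apowS]. *)
set X := (A :&: L) :\ y; set Y := A :\: L.
have cardAL : #|A :&: L| = #|X|.+1 by rewrite (cardsD1 y) inE Ay Ly.
have AyE : A :\ y = X :|: Y.
  apply/setP => z; rewrite !inE; case: (eqVneq z y) => [->|_] /=.
    by rewrite Ly.
  by case: (z \in A); case: (z \in L).
have disXY : [disjoint X & Y].
  rewrite -setI_eq0; apply/eqP/setP => z; rewrite !inE.
  by case: (z \in L); rewrite ?andbF.
have cardD (U V : {set T}) : U \subset X -> V \subset Y ->
    N (A :\: (y |: (U :|: V))) = apow (#|X| - #|U|) (#|Y| - #|V|).
  move=> sUX sVY; rewrite (IHD y) ?setU11 // -setDDl AyE.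
  rewrite -!cardsDS //; congr apow; apply: eq_card => z;
    have := subsetP sUX z; have := subsetP sVY z; rewrite !inE;
    case: (z \in A); case: (z \in L); case: (z \in U); case: (z \in V);
    case: (z == y) => //= H1 H2; by rewrite ?H1 ?H2.
rewrite cardAL apowS (recN y Ay).
congr (_ + _).
  (* The singleton block of y is the case where U and V are empty. *)
  by have:= cardD set0 set0 (sub0set _) (sub0set _); rewrite setU0 setU0 cards0 !subn0.
rewrite (reindex_onto (fun C => y |: C) (fun B => B :\ y)) /=; last first.
  by move=> B /and3P[_ By _]; rewrite setD1K.
(* The value 0 at j = 0 encodes that a larger block of y needs a right vertex, so V can range over
   all subsets of Y. *)
pose G (i j : nat) : int := if j == 0%N then 0 else apow (#|X| - i) (#|Y| - j).
rewrite (eq_bigl (fun C : {set T} => (C \subset X :|: Y) && (C :&: Y != set0))) => [|C].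
  rewrite big_mkcondr sum_subsets_split //.
  transitivity (\sum_(U : {set T} | U \subset X)
                  \sum_(V : {set T} | V \subset Y) G #|U| #|V|).
    apply: eq_bigr => U sUX; apply: eq_bigr => V sVY.
    rewrite cardD // /G cards_eq0 if_neg.
    have UY : U :&: Y = set0 by apply/eqP; rewrite setI_eq0; apply: disjointWl disXY.
    by rewrite setIUl UY set0U (setIidPl sVY).
  under [LHS]eq_bigr => U _ do rewrite (sum_subsets_card Y (G #|U|)).
  rewrite (sum_subsets_card X (fun i => \sum_(j < _) _ * G i j)).
  apply: eq_bigr => i _; congr (_ * _).
  rewrite big_ord_recl mulr0 add0r big_add1 big_mkord.
  by apply: eq_bigr.
(* It remains to match the index conditions: [y \notin C] places C inside [X :|: Y], and a neighbour
   of y in the block is an element of C in Y. *)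
rewrite -AyE setU11 subUset sub1set Ay /= subsetD1 -!andbA; apply: andb_id2l => sCA.
have -> : ((y |: C) :\ y == C) = (y \notin C).
  apply/eqP/idP => [<-|]; [by rewrite setD11 | exact: setU1K].
rewrite andbC; congr (_ && _).
apply/exists_inP/set0Pn => [[z]|[z /setIP[Cz /setDP[_ nLz]]]].
  rewrite /cut_rel Ly => /setU1P[-> /negP|Cz]; first by rewrite Ly.
  by move=> nLz; exists z; rewrite !inE Cz (subsetP sCA z Cz) andbT; case: (z \in L) nLz.
by exists z; rewrite ?setU1r // /cut_rel Ly (negbTE nLz).
Qed.

Theorem theorem10 (m n : nat) :
  (num_compositions (@Kmn m n))%:Z = \sum_(1 <= i < m.+2) acoef m i * i%:Z ^+ n.
Proof.
pose L : {set 'I_m + 'I_n} := [set inl i | i : 'I_m].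
have inL i : inl i \in L by apply: imset_f.
have inrL j : inr j \in L = false by apply/negbTE/imsetP => -[].
have eK : @Kmn m n =2 cut_rel L by move=> [i|i] [j|j]; rewrite /cut_rel ?inL ?inrL.
have cardL : #|L| = m by rewrite card_imset ?card_ord //; move=> i j [].
have cardLC : #|~: L| = n.
  by apply/eqP; rewrite -(eqn_add2l #|L|) cardsC cardL card_sum !card_ord.
rewrite -/(apow m n); have := card_partitions_in_cut L setT.
rewrite setTI setTD cardL cardLC => <-; congr (Posz _); apply: eq_card => P.
rewrite !inE; congr (_ && _); apply: eq_forallb => B; congr (_ ==> _).
apply: eq_forallb => x; congr (_ ==> _); apply: eq_forallb => y; congr (_ ==> _).
by apply: eq_connect => u v; rewrite /induced_rel /= eK.
Qed.
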